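(* Let $k,x,b$ be positive integers and let $a$ be a nonnegative integer such that $k=a+b$. Then \[\binom{2k}{k}=\binom{2a}{a}\binom{x+2b}{b}\] if and only if $x=a=1$. *)

(* Defs.v *)
From mathcomp Require Export all_boot.

(* Main.v *)
(** Write k = a + b with m = min(a, b), M = max(a, b).  A solution forces
    'C(2m + x, m) < 4 ^ m, so x is only logarithmic in m.  Cancelling factorials
    turns the equation into an identity between falling factorials of 2k and of
    k; a prime p > 2m + x dividing a number t in (2M + 2x, 2k] has t as its only
    multiple among the factors on the left, while t / 2 occurs twice on the right.
    Hence all numbers in (2M + 2x, 2k] are (2m + x)-smooth, and the theorem
    reduces to a variant of Sylvester's theorem, treated as in Erdős' proof: for
    n = 2k and K = 2m - 2x the smooth number 'C(n, K) is at most n ^ pi(2m + x),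
    which gives n ^ 5 <= K ^ 8; the primes above sqrt n then contribute little more
    than 4 ^ min(K, n / 3), which is too small when m >= 1024.  Below 1024 a table of
    primes with small gaps finishes the proof, except for m <= 8, where the
    equation itself is checked for k < 100. *)

Require Import Defs.
From mathcomp Require Import all_boot.
From mathcomp Require Import zify.
From Stdlib Require Import NArith.

Set Implicit Arguments.
Unset Strict Implicit.
Unset Printing Implicit Defensive.

(** * Prime factors of binomial coefficients *)

(** Legendre's formula for the three factorials, kept additive to avoid truncated subtraction. The
    common range is harmless, since terms with [p ^ i] above the argument vanish. *)
Lemma logn_bin_sum p n K : prime p -> K <= n ->
  logn p 'C(n, K) + \sum_(1 <= i < n.+1) (K %/ p ^ i + (n - K) %/ p ^ i)
  = \sum_(1 <= i < n.+1) n %/ p ^ i.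
Proof.
move=> pp leKn.
have ext j : j <= n -> logn p j`! = \sum_(1 <= i < n.+1) j %/ p ^ i.
  move=> lejn; rewrite logn_fact // [RHS](big_cat_nat _ (n := j.+1)) //=.
  rewrite [X in _ = _ + X]big_nat_cond [X in _ = _ + X]big1 ?addn0 // => i.
  rewrite andbT => /andP[ltji _]; rewrite divn_small //.
  by apply: leq_ltn_trans (ltn_expl i (prime_gt1 pp)); lia.
rewrite big_split /= -!ext ?leq_subr // -(bin_fact leKn).
by rewrite !lognM ?muln_gt0 ?fact_gt0 ?bin_gt0.
Qed.

(** Kummer's argument: adding [K] and [n - K] in base [p] produces at most one carry per power
    [p ^ i], and only powers with [i <= v] can produce one. *)
Lemma logn_bin_le p n K v : prime p -> K <= n -> n < p ^ v.+1 ->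
  logn p 'C(n, K) <= v.
Proof.
move=> pp leKn ltn.
rewrite -(leq_add2r (\sum_(1 <= i < n.+1) (K %/ p ^ i + (n - K) %/ p ^ i))).
rewrite logn_bin_sum //.
have -> : v = \sum_(1 <= i < v.+1) 1 by rewrite sum_nat_const_nat; lia.
have p0 i : 0 < p ^ i by rewrite expn_gt0 prime_gt0.
have carry i : n %/ p ^ i <= 1 + (K %/ p ^ i + (n - K) %/ p ^ i).
  rewrite -{1}(subnKC leKn) divnD // addnC.
  by rewrite leq_add2r leq_b1.
have [lenv|ltvn] := leqP n v.
  rewrite [X in _ <= X + _](big_cat_nat _ (n := n.+1)) //=.
  rewrite addnAC; apply: leq_trans (leq_addr _ _).
  by rewrite -big_split; apply: leq_sum.
rewrite (big_cat_nat _ (n := v.+1)) //=; last by lia.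
rewrite [X in _ + X]big_nat_cond [X in _ + X]big1 ?addn0; last first.
  move=> i; rewrite andbT => /andP[ltvi _]; rewrite divn_small //.
  by apply: leq_trans ltn _; rewrite leq_exp2l ?prime_gt1.
rewrite [X in _ <= _ + X](big_cat_nat _ (n := v.+1)) //=; last by lia.
rewrite addnA; apply: leq_trans (leq_addr _ _).
by rewrite -big_split; apply: leq_sum.
Qed.

Lemma pfactor_bin_le p n K : prime p -> 0 < n -> K <= n ->
  p ^ logn p 'C(n, K) <= n.
Proof.
move=> pp n0 leKn.
apply: leq_trans (trunc_logP (prime_gt1 pp) n0).
rewrite leq_exp2l ?prime_gt1 //; apply: logn_bin_le => //.
exact: trunc_log_ltn (prime_gt1 pp).
Qed.

(** The quotient of [n] by [p] is at most 2 and those of [K] and [n - K] are at least 1, so [p]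
    itself gives no carry; higher powers exceed [n] because [n < 3 * p <= p ^ 2]. *)
Lemma logn_bin_middle p n K : prime p -> 3 < p -> 2 * K <= n -> p <= K ->
  n < 3 * p -> logn p 'C(n, K) = 0.
Proof.
move=> pp p3 le2K lepK ltn.
have leKn : K <= n by lia.
suff: logn p 'C(n, K) <= 0 by lia.
rewrite -(leq_add2r (\sum_(1 <= i < n.+1) (K %/ p ^ i + (n - K) %/ p ^ i))).
rewrite logn_bin_sum //; apply: leq_sum => i _.
case: i => [|[|i]]; first by rewrite !expn0 !divn1; lia.
  rewrite expn1.
  have : n %/ p < 3 by rewrite ltn_divLR; lia.
  have : 0 < K %/ p by rewrite divn_gt0; lia.
  have : 0 < (n - K) %/ p by rewrite divn_gt0; lia.
  lia.
rewrite divn_small // (leq_trans ltn) //.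
apply: (@leq_trans (p ^ 2)); first by rewrite -mulnn leq_mul2r (ltnW p3) orbT.
by rewrite leq_exp2l // prime_gt1.
Qed.

Lemma count_coprime6 n :
  \sum_(0 <= p < n) ((p %% 6 == 1) + (p %% 6 == 5)) = (n + 4) %/ 6 + n %/ 6.
Proof.
elim: n => [|n IHn]; first by rewrite big_geq.
rewrite big_nat_recr //= IHn; lia.
Qed.

Lemma prime_mod6 p : prime p -> 4 <= p -> (p %% 6 == 1) || (p %% 6 == 5).
Proof.
move=> pp p4.
have n2 : ~~ (2 %| p) by apply/negP => /(prime_nt_dvdP pp); lia.
have n3 : ~~ (3 %| p) by apply/negP => /(prime_nt_dvdP pp); lia.
by move: n2 n3; lia.
Qed.

(** Primes from 4 on lie in two residue classes modulo 6. This density 1/3 is the source of the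
    [%/ 3] in all prime counts below. *)
Lemma count_prime_interval u L : 4 <= u ->
  \sum_(u <= p < u + L | prime p) 1 <= L %/ 3 + 1.
Proof.
move=> u4.
apply: (@leq_trans (\sum_(u <= p < u + L) ((p %% 6 == 1) + (p %% 6 == 5)))).
  rewrite big_mkcond /= big_nat_cond [X in _ <= X]big_nat_cond.
  apply: leq_sum => p /andP[/andP[up _] _]; case: ifP => // pp.
  have := @prime_mod6 p pp; lia.
have := count_coprime6 (u + L).
rewrite (big_cat_nat _ (n := u)) ?leq_addr //= count_coprime6; lia.
Qed.

Lemma count_prime_le n : \sum_(0 <= p < n.+1 | prime p) 1 <= n %/ 3 + 2.
Proof.
have [le3n|lt3n] := leqP 3 n; last first.
  by case: n lt3n => [|[|[|n]]] // _; rewrite unlock.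
rewrite (big_cat_nat _ (n := 4)) //=.
have -> : \sum_(0 <= p < 4 | prime p) 1 = 2 by rewrite unlock.
have := @count_prime_interval 4 (n - 3) isT.
have -> : 4 + (n - 3) = n.+1 by lia.
lia.
Qed.

(** The ratio of neighbours in [m], free of division. The case [x = 0] serves central coefficients,
    [x = 1] the middle of odd rows, and [x = m] the growth of ['C(3 * m, m)]. *)
Lemma bin_2D_succ m x :
  m.+1 * (m + x).+1 * 'C(2 * m.+1 + x, m.+1) =
  (2 * m + x).+1 * (2 * m + x).+2 * 'C(2 * m + x, m).
Proof.
have e1 := mul_bin_diag (2 * m + x).+2 m.
have e2 := mul_bin_down (2 * m + x).+1 m.
have -> : 2 * m.+1 + x = (2 * m + x).+2 by lia.
have {}e2 : (2 * m + x).+1 * 'C(2 * m + x, m) = (m + x).+1 * 'C((2 * m + x).+1, m).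
  by rewrite e2; congr (_ * _); lia.
by rewrite mulnAC -e1 /= [RHS]mulnAC e2 [RHS]mulnC mulnA mulnAC.
Qed.

Lemma bin_2D1_le h : 'C(2 * h + 1, h) <= 4 ^ h.
Proof.
elim: h => [|h IHh]; first by rewrite bin0.
have := bin_2D_succ h 1; rewrite expnS; nia.
Qed.

(** Erdős' induction: an even [n > 2] adds no prime, and for [n = 2h + 1] the primes in (h + 1, n]
    all divide ['C(n, h)], which is at most [4 ^ h]. *)
Lemma primorial_le n : \prod_(0 <= p < n.+1 | prime p) p <= 4 ^ n.
Proof.
have [N] := ubnP n; elim: N n => // N IHN n ltnN.
have [lt2n|] := ltnP 2 n; last first.
  by case: n {ltnN} => [|[|[|n]]] // _; rewrite unlock.
have [odd_n|even_n] := boolP (odd n); last first.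
  rewrite big_mkcond /=.
rewrite big_nat_recr //= -big_mkcond /=.
  case: ifP => [pp|_]; first by case: (even_prime pp); lia.
  case: n lt2n ltnN {even_n} => // n _ ltnN; rewrite muln1 expnS.
  by apply: leq_trans (IHN n _) _; lia.
pose h := n./2; have def_n : n = h.*2.+1 by rewrite /h; lia.
rewrite (big_cat_nat _ (n := h.+2)) //=; last by lia.
have -> : 4 ^ n = 4 ^ h.+1 * 4 ^ h by rewrite -expnD; congr (_ ^ _); lia.
apply: leq_mul; first by apply: IHN; lia.
have dvdC : \prod_(h.+2 <= p < n.+1 | prime p) p %| 'C(n, h).
  have : forall r, uniq r -> all prime r ->
     (forall p, p \in r -> p %| 'C(n, h)) -> \prod_(p <- r) p %| 'C(n, h).
    elim=> [|p r IHr] /=; first by rewrite big_nil dvd1n.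
    move=> /andP[pr ur] /andP[pp ar] Hr; rewrite big_cons Gauss_dvd.
      by rewrite Hr ?mem_head // IHr // => q qr; apply: Hr; rewrite in_cons qr orbT.
    rewrite prime_coprime //; apply: contra pr.
    rewrite Euclid_dvd_prod // big_has => /hasP[q qr].
    by rewrite dvdn_prime2 // ?(allP ar) // => /eqP ->.
  rewrite -big_filter; apply.
  - by rewrite filter_uniq // iota_uniq.
  - exact: filter_all.
  move=> p; rewrite mem_filter mem_index_iota => /and3P[pp lehp lepn].
  (* The prime divides [n]! but neither [h]! nor [(n - h)]!, as both [h] and [n - h = h + 1] are
     below [p]. *)
  have : p %| n`! by rewrite dvdn_fact // prime_gt0.
  have lehn : h <= n by lia.
  rewrite -(bin_fact lehn) Euclid_dvdM // => /orP[//|].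
  have ndvd j : j < p -> ~~ (p %| j`!).
    by move=> ltjp; rewrite fact_prod Euclid_dvd_prod // big_has; apply/hasPn => i;
       rewrite mem_index_iota /= => /andP[i0 ij]; rewrite gtnNdvd //; lia.
  by rewrite Euclid_dvdM // (negbTE (ndvd _ _)) ?(negbTE (ndvd _ _)) //; lia.
have C0 : 0 < 'C(n, h) by rewrite bin_gt0; lia.
apply: leq_trans (dvdn_leq C0 dvdC) _.
by have := bin_2D1_le h; congr ('C(_, _) <= _); lia.
Qed.

Lemma prod_primes_smooth N y : 0 < N ->
  (forall p, prime p -> p %| N -> p <= y) ->
  N = \prod_(0 <= p < y.+1 | prime p) p ^ logn p N.
Proof.
move=> N0 smooth; rewrite -{1}(partnT N0).
rewrite (@widen_partn (maxn N y)) ?leq_maxl //.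
rewrite (big_cat_nat _ (n := y.+1)) //=; last by rewrite ltnS leq_maxr.
rewrite [X in _ * X]big_nat_cond [X in _ * X]big1 ?muln1; last first.
  move=> p; rewrite andbT => /andP[ltyp _].
  case: (posnP (logn p N)) => [-> //|].
  by rewrite logn_gt0 mem_primes => /and3P[pp _ /(smooth p pp)]; lia.
rewrite [RHS]big_mkcond; apply: eq_bigr => p _.
by case: ifP => // pp; rewrite lognE pp.
Qed.

(** Every prime power exactly dividing ['C(n, K)] is at most [n], so smoothness bounds the
    coefficient by one factor [n] per available prime. *)
Lemma bin_le_exp_count n K y : 0 < n -> K <= n ->
  (forall p, prime p -> p %| 'C(n, K) -> p <= y) ->
  'C(n, K) <= n ^ (\sum_(0 <= p < y.+1 | prime p) 1).
Proof.
move=> n0 leKn smooth; have C0 : 0 < 'C(n, K) by rewrite bin_gt0.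
rewrite {1}(prod_primes_smooth C0 smooth) expn_sum.
by apply: leq_prod => p pp; rewrite expn1; apply: pfactor_bin_le.
Qed.

Lemma bin_le_exp n K y : 0 < n -> K <= n ->
  (forall p, prime p -> p %| 'C(n, K) -> p <= y) ->
  'C(n, K) <= n ^ (y %/ 3 + 2).
Proof.
move=> n0 leKn /(bin_le_exp_count n0 leKn)/leq_trans; apply.
by rewrite leq_pexp2l // count_prime_le.
Qed.

(* Primes up to sqrt n contribute at most n each, larger ones at most
   themselves, and those in (n/3, K] nothing; hence the choice of w. *)
Lemma bin_le_primorial n K y w s : 2 * K <= n -> K <= y -> s <= y ->
  3 <= w <= K -> (w < K -> n < 3 * w.+1) -> n < s.+1 ^ 2 ->
  (forall p, prime p -> p %| 'C(n, K) -> p <= y) ->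
  'C(n, K) <= n ^ (s %/ 3 + 2 + ((y - K) %/ 3 + 1)) * 4 ^ w.
Proof.
move=> le2K leKy lesy /andP[w3 lewK] hw hs smooth.
have n0 : 0 < n by lia.
have leKn : K <= n by lia.
have C0 : 0 < 'C(n, K) by rewrite bin_gt0.
rewrite {1}(prod_primes_smooth C0 smooth).
apply: (@leq_trans (\prod_(0 <= p < y.+1 | prime p)
  ((if p < s.+1 then n else 1) * (if K < p then n else 1)
   * (if p < w.+1 then p else 1)))).
  apply: leq_prod => p pp.
  have p0 := prime_gt0 pp.
  have vn : p ^ logn p 'C(n, K) <= n by apply: pfactor_bin_le.
  have i1 (b : bool) m : 0 < m -> 0 < if b then m else 1 by case: b.
  have [_|ltsp] /= := ltnP p s.+1.
    by apply: leq_trans vn _; rewrite -mulnA leq_pmulr // muln_gt0 !i1.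
  have [_|lepK] /= := ltnP K p.
    by rewrite mul1n; apply: leq_trans vn _; rewrite leq_pmulr // i1.
  rewrite !mul1n; have [_|ltwp] /= := ltnP p w.+1; last first.
    by rewrite logn_bin_middle //; lia.
  rewrite -[X in _ <= X]expn1 leq_pexp2l //.
  apply: logn_bin_le => //; apply: leq_trans hs _.
  by rewrite leq_exp2r.
rewrite !big_split /= expnD leq_mul //; last first.
  apply: leq_trans (primorial_le w).
  rewrite (@big_nat_widen _ _ _ _ w.+1 y.+1) //; last by lia.
  by rewrite big_mkcondr.
rewrite leq_mul // -big_mkcondr /=.
  rewrite -(@big_nat_widen _ _ _ _ s.+1 y.+1) //=.
  apply: (@leq_trans (n ^ \sum_(0 <= p < s.+1 | prime p) 1)).
    by rewrite expn_sum; apply: leq_prod => p _; rewrite expn1.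
  by rewrite leq_pexp2l // count_prime_le.
rewrite -(@big_nat_widenl _ _ _ K.+1 0) //=.
apply: (@leq_trans (n ^ \sum_(K.+1 <= p < y.+1 | prime p) 1)).
  by rewrite expn_sum; apply: leq_prod => p _; rewrite expn1.
rewrite leq_pexp2l //.
have /(@count_prime_interval _ (y - K)) : 4 <= K.+1 by lia.
by have -> : K.+1 + (y - K) = y.+1 by lia.
Qed.

(** Factor by factor, (n - i) / (N - i) <= n / N. With [c < K] it says that C(n, K) / n ^ c does not
    decrease in [n]. *)
Lemma bin_ratio_expn n N K c : n <= N -> c <= K ->
  'C(n, K) * N ^ c <= 'C(N, K) * n ^ c.
Proof.
move=> lenN lecK; have [N0|N0] := posnP N.
  by move: lenN; rewrite N0 leqn0 => /eqP ->.
have [n0|n0] := posnP n.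
  case: K lecK => [|K] lecK; first by case: c lecK => // _; rewrite !bin0.
  by rewrite n0 bin0n.
suff hK : 'C(n, K) * N ^ K <= 'C(N, K) * n ^ K.
  rewrite -(@leq_pmul2r (N ^ (K - c))) ?expn_gt0 ?N0 //.
  rewrite -mulnA -expnD subnKC //; apply: leq_trans hK _.
  rewrite -{2}(subnKC lecK) expnD mulnA leq_mul2l.
  by case: (K - c) => [|e]; rewrite ?expn0 ?leq_exp2r ?lenN ?orbT.
rewrite -(@leq_pmul2r K`!) ?fact_gt0 // mulnAC bin_ffact [X in _ <= X]mulnAC.
rewrite bin_ffact !ffact_prod -[K in N ^ K]card_ord -[K in n ^ K]card_ord.
rewrite -!prod_nat_const -!big_split /=; apply: leq_prod => i _; nia.
Qed.

Lemma bin_3n_succ w :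
  2 * w.+1 * (2 * w).+1 * 'C(3 * w.+1, w.+1) =
  3 * (3 * w).+1 * (3 * w).+2 * 'C(3 * w, w).
Proof.
have e1 := bin_2D_succ w w.
have e2 := mul_bin_down (3 * w.+1) w.+1.
have d1 : 2 * w.+1 + w = (3 * w).+2 by lia.
have d2 : 2 * w + w = 3 * w by lia.
have d3 : (3 * w.+1).-1 = (3 * w).+2 by lia.
have d4 : 3 * w.+1 - w.+1 = 2 * w.+1 by lia.
have d5 : w + w = 2 * w by lia.
move: e1 e2; rewrite d1 d2 d3 d4 d5; nia.
Qed.

(** One step multiplies ['C(3 * w, w)] by nearly 27/4; the factor [w.+1] absorbs the deficit. *)
Lemma bin_3n_ge w : 3 * 27 ^ w <= w.+1 * 4 ^ w * 'C(3 * w.+1, w.+1).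
Proof.
elim: w => [|w IHw]; first by [].
have := bin_3n_succ w.+1; rewrite !expnS.
set c := 'C(_, _) in IHw *; set c' := 'C(_, _).
move: (27 ^ w) (4 ^ w) IHw => p q IHw e.
have key : 27 * w.+1 * c <= 4 * w.+2 * c' by nia.
have : 27 * (3 * p) <= 27 * (w.+1 * q * c) by rewrite leq_mul2l IHw orbT.
nia.
Qed.

(** * Smoothness forced by the equation *)

Lemma prime_dvd_ffact p n K : prime p -> K <= n -> p %| n ^_ K ->
  exists2 t, n - K < t <= n & p %| t.
Proof.
move=> pp leKn; rewrite ffact_prod Euclid_dvd_prod // big_has => /hasP[i _ pi].
by exists (n - i) => //; have := ltn_ord i; lia.
Qed.

Lemma dvd_close p s t : p %| s -> p %| t -> s < t + p -> t < s + p -> s = t.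
Proof.
move=> ps pt; have [lest|ltts] := leqP s t.
  by move=> _ h; have : p %| t - s by [rewrite dvdn_sub]; move/dvdn_leq; lia.
by move=> h _; have : p %| s - t by [rewrite dvdn_sub]; move/dvdn_leq; lia.
Qed.

(** At most [p] consecutive factors contain only one multiple of [p], so [t] carries the whole
    valuation. *)
Lemma logn_ffact p n K t : prime p -> K <= p -> K <= n -> n - K < t <= n ->
  p %| t -> logn p (n ^_ K) = logn p t.
Proof.
move=> pp leKp leKn /andP[ltt letn] pt.
have ltiK : n - t < K by lia.
rewrite ffact_prod (bigD1 (Ordinal ltiK)) //= subKn //.
have npP : ~~ (p %| \prod_(i < K | i != Ordinal ltiK) (n - i)).
  rewrite Euclid_dvd_prod // big_has_cond; apply/hasPn => i _ /=.
  apply/negP => /andP[neqi pi]; have lti := ltn_ord i.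
  have neqv : i <> n - t :> nat by move=> e; case/eqP: neqi; apply: val_inj.
  have eqt : n - i = t by apply: (dvd_close pi pt); lia.
  by apply: neqv; lia.
rewrite lognM; [|lia|by case: posnP npP => // ->; rewrite dvdn0].
by rewrite [X in _ + X]lognE (negbTE npP) !andbF addn0.
Qed.

Lemma logn_coprime_fact p j : prime p -> j < p -> logn p j`! = 0.
Proof.
move=> pp ltjp; rewrite logn_fact // big_nat_cond big1 // => i.
rewrite andbT => /andP[i0 _]; rewrite divn_small //.
by apply: leq_trans ltjp _; rewrite -{1}(expn1 p) leq_exp2l // prime_gt1.
Qed.

Lemma equation_fact a b x :
  'C(2 * (a + b), a + b) = 'C(2 * a, a) * 'C(x + 2 * b, b) ->
  (2 * (a + b))`! * a`! ^ 2 * b`! * (x + b)`! =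
  (a + b)`! ^ 2 * (2 * a)`! * (x + 2 * b)`!.
Proof.
move=> E.
have lea : a <= 2 * a by lia.
have leb : b <= x + 2 * b by lia.
have lek : a + b <= 2 * (a + b) by lia.
rewrite -(bin_fact lek) -(bin_fact lea) -(bin_fact leb) E.
have -> : 2 * (a + b) - (a + b) = a + b by lia.
have -> : 2 * a - a = a by lia.
have -> : x + 2 * b - b = x + b by lia.
lia.
Qed.

(** The form used when [a] is the smaller parameter: the factorials of [b], [x + b] and [x + 2 * b]
    are cancelled, leaving the intervals (2b + x, 2k] on the left and (b, k], (b + x, k] on the
    right. *)
Lemma equation_ffact_l a b x : x <= a ->
  'C(2 * (a + b), a + b) = 'C(2 * a, a) * 'C(x + 2 * b, b) ->
  (2 * (a + b)) ^_ (2 * a - x) * a`! ^ 2 =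
  (2 * a)`! * (a + b) ^_ a * (a + b) ^_ (a - x).
Proof.
move=> lexa /equation_fact E.
have e1 : (2 * (a + b)) ^_ (2 * a - x) * (x + 2 * b)`! = (2 * (a + b))`!.
  by rewrite -[RHS](@ffact_fact _ (2 * a - x)); [congr (_ * _`!); lia|lia].
have e2 : (a + b) ^_ a * b`! = (a + b)`!.
  by rewrite -[RHS](@ffact_fact _ a); [congr (_ * _`!); lia|lia].
have e3 : (a + b) ^_ (a - x) * (x + b)`! = (a + b)`!.
  by rewrite -[RHS](@ffact_fact _ (a - x)); [congr (_ * _`!); lia|lia].
have := fact_gt0 b; have := fact_gt0 (x + b); have := fact_gt0 (x + 2 * b).
move: E; rewrite -e1 -!mulnn -{1}e2 -e3.
set u := (x + 2 * b)`!; set v := (x + b)`!; set w := b`! => E u0 v0 w0.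
have m0 : 0 < u * v * w by rewrite !muln_gt0 u0 v0 w0.
apply/eqP; rewrite -(eqn_pmul2r m0); apply/eqP; lia.
Qed.

Lemma equation_ffact_r a b x :
  'C(2 * (a + b), a + b) = 'C(2 * a, a) * 'C(x + 2 * b, b) ->
  (2 * (a + b)) ^_ (2 * b) * b`! * (x + b)`! =
  ((a + b) ^_ b) ^ 2 * (x + 2 * b)`!.
Proof.
move=> /equation_fact E.
have e1 : (2 * (a + b)) ^_ (2 * b) * (2 * a)`! = (2 * (a + b))`!.
  by rewrite -[RHS](@ffact_fact _ (2 * b)); [congr (_ * _`!); lia|lia].
have e2 : (a + b) ^_ b * a`! = (a + b)`!.
  by rewrite -[RHS](@ffact_fact _ b); [congr (_ * _`!); lia|lia].
have := fact_gt0 a; have := fact_gt0 (2 * a).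
move: E; rewrite -e1 -e2 !expnMn.
move=> E u0 v0.
have m0 : 0 < (2 * a)`! * a`! ^ 2 by rewrite muln_gt0 u0 expn_gt0 v0.
apply/eqP; rewrite -(eqn_pmul2r m0); apply/eqP; lia.
Qed.

(** Suppose [p > 2 * a]. Then [p] divides none of the remaining factorials, so it divides some [u]
    in (b, k]. Both [t] and [2 * u] are multiples of [p] less than [p] apart, hence equal. As
    [t > 2 * b + 2 * x], this [u] lies in both intervals on the right, and the valuation of [t]
    would be twice itself. *)
Lemma smooth_l a b x p t : x <= a -> 0 < a ->
  'C(2 * (a + b), a + b) = 'C(2 * a, a) * 'C(x + 2 * b, b) ->
  prime p -> 2 * b + 2 * x < t <= 2 * (a + b) -> p %| t -> p <= 2 * a.
Proof.
move=> lexa a0 /(equation_ffact_l lexa) E pp /andP[ltt let_] pt.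
rewrite leqNgt; apply/negP => lt2ap.
have v0 : 0 < logn p t by rewrite logn_gt0 mem_primes pp pt; lia.
have := congr1 (logn p) E.
rewrite !lognM ?muln_gt0 ?expn_gt0 ?fact_gt0 ?ffact_gt0 //; try lia.
rewrite ?lognX !logn_coprime_fact //; last by lia.
rewrite (@logn_ffact _ _ _ t) //; try lia.
move=> e.
have [u hu pu] : exists2 u, b < u <= a + b & p %| u.
  have /orP[] : (p %| (a + b) ^_ a) || (p %| (a + b) ^_ (a - x)).
  - have : (0 < logn p ((a + b) ^_ a)) || (0 < logn p ((a + b) ^_ (a - x))) by lia.
    by rewrite !logn_gt0 !mem_primes => /orP[] /and3P[_ _ ->]; rewrite ?orbT.
  - by case/prime_dvd_ffact => [||u hu pu] //; [lia|exists u => //; lia].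
  - by case/prime_dvd_ffact => [||u hu pu] //; [lia|exists u => //; lia].
have def_t : t = 2 * u.
  by apply: (dvd_close pt); [rewrite dvdn_mull | lia | lia].
move: e; rewrite !(@logn_ffact _ _ _ u) //; try lia.
have l2 : logn p 2 = 0 by rewrite lognE pp gtnNdvd //; lia.
have lt : logn p t = logn p u by rewrite def_t lognM //; lia.
by rewrite lt in v0 *; lia.
Qed.

(** The mirror image of [smooth_l]. Here the falling factorial on the right is a square, so [u]
    always counts twice and the whole interval (2a, 2k] is covered; the remaining factorial of
    [x + 2 * b] raises the bound on [p]. *)
Lemma smooth_r a b x p t : 0 < b ->
  'C(2 * (a + b), a + b) = 'C(2 * a, a) * 'C(x + 2 * b, b) ->
  prime p -> 2 * a < t <= 2 * (a + b) -> p %| t -> p <= 2 * b + x.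
Proof.
move=> b0 /equation_ffact_r E pp /andP[ltt let_] pt.
rewrite leqNgt; apply/negP => lt2bp.
have v0 : 0 < logn p t by rewrite logn_gt0 mem_primes pp pt; lia.
have := congr1 (logn p) E.
rewrite !lognM ?muln_gt0 ?expn_gt0 ?fact_gt0 ?ffact_gt0 //; try lia.
rewrite ?lognX !logn_coprime_fact //; try lia.
rewrite (@logn_ffact _ _ _ t) //; try lia.
move=> e.
have [u hu pu] : exists2 u, a < u <= a + b & p %| u.
  have : p %| (a + b) ^_ b.
    have : 0 < logn p ((a + b) ^_ b) by lia.
    by rewrite !logn_gt0 !mem_primes => /and3P[_ _ ->].
  by case/prime_dvd_ffact => [||u hu pu] //; [lia|exists u => //; lia].
have def_t : t = 2 * u.
  by apply: (dvd_close pt); [rewrite dvdn_mull | lia | lia].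
move: e; rewrite (@logn_ffact _ _ _ u) //; try lia.
have l2 : logn p 2 = 0 by rewrite lognE pp gtnNdvd //; lia.
have lt : logn p t = logn p u by rewrite def_t lognM //; lia.
by rewrite lt in v0 *; lia.
Qed.

(** * Bounds on x *)

(** Falling factorials in binary, so that numerical checks can be evaluated. Binomials are compared
    after multiplication by [k]!, which is [ffactN k k]. *)
Fixpoint ffactN (n : N) (k : nat) : N :=
  if k is k'.+1 then N.mul n (ffactN (N.pred n) k') else 1%num.

Lemma ffactNE n k : N.of_nat (n ^_ k) = ffactN (N.of_nat n) k.
Proof.
elim: k n => [|k IHk] n //.
by rewrite ffactnS Nat2N.inj_mul IHk Nat2N.inj_pred.
Qed.

Lemma expNE m e : N.of_nat (m ^ e) = N.pow (N.of_nat m) (N.of_nat e).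
Proof. by lia. Qed.

Lemma bin_ge_expN m e n k :
  N.leb (N.pow (N.of_nat m) (N.of_nat e) * ffactN (N.of_nat k) k)
        (ffactN (N.of_nat n) k) -> m ^ e <= 'C(n, k).
Proof.
rewrite -!ffactNE ffactnn -expNE => h.
by rewrite -(@leq_pmul2r k`!) ?fact_gt0 // bin_ffact; lia.
Qed.

(** The hypothesis on [x] says exactly that passing from [m] to [m.+1] multiplies the coefficient by
    at most 4, so the lower bound descends. One evaluation at a large [m] then serves all smaller
    ones. *)
Lemma bin_2D_exp4_pred m x : x.+1 * x <= 2 * (m + x).+1 ->
  4 ^ m.+1 <= 'C(2 * m.+1 + x, m.+1) -> 4 ^ m <= 'C(2 * m + x, m).
Proof.
move=> hx; have := bin_2D_succ m x; rewrite expnS.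
set c := 'C(_, m.+1); set d := 'C(_, m) => e h.
have r : (2 * m + x).+1 * (2 * m + x).+2 <= 4 * (m.+1 * (m + x).+1) by nia.
have m0 : 0 < 4 * (m.+1 * (m + x).+1) by [].
rewrite -(@leq_pmul2l _ _ _ m0).
apply: (@leq_trans (m.+1 * (m + x).+1 * c)); first by nia.
by rewrite e leq_mul2r r orbT.
Qed.

Lemma bin_2D_exp4_down m0 m1 x : x.+1 * x <= 2 * (m0 + x).+1 -> m0 <= m1 ->
  4 ^ m1 <= 'C(2 * m1 + x, m1) -> 4 ^ m0 <= 'C(2 * m0 + x, m0).
Proof.
move=> hx /subnK <-; elim: (m1 - m0) => [//|j IHj] h.
by apply/IHj/bin_2D_exp4_pred; [nia|].
Qed.

Lemma x_lt_of_exp4 m x y : 'C(2 * m + x, m) < 4 ^ m -> 4 ^ m <= 'C(2 * m + y, m) ->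
  x < y.
Proof.
move=> h1 h2; rewrite ltnNge; apply/negP => leyx.
have lexy : 2 * m + y <= 2 * m + x by rewrite leq_add2l.
by have := leq_trans h2 (leq_bin2l m lexy); rewrite leqNgt h1.
Qed.

Lemma x_le2 m x : 2 <= m <= 13 -> 'C(2 * m + x, m) < 4 ^ m -> x <= 2.
Proof.
move=> hm /x_lt_of_exp4 -/(_ 3); rewrite ltnS; apply.
(* For [x = 3] the descent is valid down to [m = 2], and 13 is the last [m] at which the inequality
   holds. *)
apply: (@bin_2D_exp4_down _ 13); [lia|lia|].
by apply: bin_ge_expN; vm_compute.
Qed.

Lemma x_le4 m x : 9 <= m <= 255 -> 'C(2 * m + x, m) < 4 ^ m -> x <= 4.
Proof.
move=> hm /x_lt_of_exp4 -/(_ 5); rewrite ltnS; apply.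
(* For [x = 5] the descent is valid down to exactly [m = 9]; from 256 = 4 ^ 4 on, [x_le_log] takes
   over. *)
apply: (@bin_2D_exp4_down _ 255); [lia|lia|].
apply: bin_ge_expN.
by vm_cast_no_check (erefl true).
Qed.

(** The bound C(2m, m) >= 4 ^ m / (2 sqrt m), squared to stay in integers. *)
Lemma central_sq m : 0 < m -> 16 ^ m <= 4 * m * 'C(2 * m, m) ^ 2.
Proof.
case: m => // m _; elim: m => [//|m IHm].
have := bin_2D_succ m.+1 0; rewrite !addn0 expnS.
set c := 'C(_, m.+2); set d := 'C(_, m.+1) in IHm *; set p := 16 ^ _ in IHm * => e.
have {}e : m.+2 * c = 2 * (2 * m.+1).+1 * d.
  by apply/eqP; rewrite -(@eqn_pmul2l m.+2) //; apply/eqP; lia.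
rewrite -(@leq_pmul2l m.+2) //.
apply: (@leq_trans (m.+2 * (16 * (4 * m.+1 * d ^ 2)))).
  by rewrite !leq_mul2l IHm !orbT.
have -> : m.+2 * (4 * m.+2 * c ^ 2) = 4 * (m.+2 * c) ^ 2 by lia.
have : 16 * m.+2 * m.+1 <= 4 * (2 * m.+1).+1 ^ 2 by lia.
by rewrite e; nia.
Qed.

(** Raising [x] by one multiplies the coefficient by (2m + x + 1) / (m + x + 1), which is at least
    3/2 while [x < m]. *)
Lemma bin_2D_pow m x : x <= m -> 3 ^ x * 'C(2 * m, m) <= 2 ^ x * 'C(2 * m + x, m).
Proof.
elim: x => [|x IHx] ltxm; first by rewrite addn0.
have {}IHx := IHx (ltnW ltxm); rewrite !expnS addnS.
have := mul_bin_down (2 * m + x).+1 m.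
have -> : (2 * m + x).+1 - m = (m + x).+1 by lia.
rewrite /=; move: ('C(2 * m, m)) ('C(2 * m + x, m)) ('C(_.+1, _)) IHx => c d e.
move: (3 ^ x) (2 ^ x) => p q IHx eq.
have h : 3 * d <= 2 * e by nia.
have : 3 * (p * c) <= 3 * (q * d) by rewrite leq_mul2l IHx orbT.
have : q * (3 * d) <= q * (2 * e) by rewrite leq_mul2l h orbT.
lia.
Qed.

(** For y = 2(t + 2) the gain (9/4) ^ (t + 2) exceeds 2 ^ (t + 2), which outweighs the loss 2 sqrt m
    < 2 ^ (t + 2) of the central coefficient; hence [x < y]. *)
Lemma x_le_log m x t : 2 <= t -> 4 ^ t <= m < 4 ^ t.+1 ->
  'C(2 * m + x, m) < 4 ^ m -> x <= 2 * t + 3.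
Proof.
move=> t2 /andP[lem ltm] /x_lt_of_exp4 -/(_ (2 * t.+2)).
have -> : (x < 2 * t.+2) = (x <= 2 * t + 3) by apply/idP/idP; lia.
apply; have h : 2 * t.+2 <= m.
  apply: leq_trans lem; elim: t t2 {ltm} => // t IHt.
  by rewrite leq_eqVlt => /predU1P[[<-]//|lt2]; have := IHt lt2; rewrite expnS; lia.
have m0 : 0 < m by lia.
have := bin_2D_pow h; have := central_sq m0; rewrite !expnM.
set c := 'C(_, _); set d := 'C(2 * m + _, _) => h1 h2.
have {h2}h2 : 2 ^ t.+2 * c <= d.
  rewrite -(@leq_pmul2l ((2 ^ 2) ^ t.+2)) ?expn_gt0 //.
  apply: leq_trans h2; rewrite mulnA -expnMn leq_mul2r.
  by rewrite leq_exp2r // orbT.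
apply: leq_trans h2.
rewrite -(@leq_exp2r _ _ 2) // expnMn.
have -> : (4 ^ m) ^ 2 = 16 ^ m by rewrite -expnM mulnC expnM.
have -> : (2 ^ t.+2) ^ 2 = 4 * 4 ^ t.+1 by rewrite -expnM mulnC expnM expnS.
by apply: leq_trans h1 _; rewrite leq_mul2r leq_mul2l (ltnW ltm) !orbT.
Qed.

(** * The asymptotic estimates *)

Lemma leq_exp2rW m n e : m <= n -> m ^ e <= n ^ e.
Proof. by case: e => [|e] lemn //; rewrite leq_exp2r. Qed.

Lemma exists_root n e : 0 < e -> exists r, r ^ e <= n < r.+1 ^ e.
Proof.
move=> e0; elim: n => [|n [r /andP[ler ltr]]].
  by exists 0; rewrite exp0n // exp1n.
have [lt1|le1] := ltnP n.+1 (r.+1 ^ e).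
  by exists r; rewrite lt1 (leq_trans ler) //.
exists r.+1; rewrite le1 /=; apply: leq_ltn_trans ltr _.
by rewrite ltn_exp2r.
Qed.

(** Compare (n / K) ^ K <= C(n, K) with the smooth upper bound. The hypothesis on [y] makes the
    prime count at most 3K/8, so n ^ (5K/8) <= K ^ K. *)
Lemma smooth_bin_pow n K y : 0 < K <= n -> 8 * y + 48 <= 9 * K ->
  (forall p, prime p -> p %| 'C(n, K) -> p <= y) -> n ^ 5 <= K ^ 8.
Proof.
move=> /andP[K0 leKn] hy smooth.
have n0 : 0 < n by lia.
have h1 := bin_le_exp n0 leKn smooth.
have := bin_ratio_expn leKn (leqnn K); rewrite binn mul1n => h2.
have {h1}h2 : n ^ K <= n ^ (y %/ 3 + 2) * K ^ K.
  by apply: leq_trans h2 _; rewrite leq_mul2r h1 orbT.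
have leeK : y %/ 3 + 2 <= K by lia.
move: h2; rewrite -{1}(subnKC leeK) expnD leq_pmul2l ?expn_gt0 ?n0 // => h2.
rewrite -(@leq_exp2r _ _ K) //.
apply: (@leq_trans (n ^ ((K - (y %/ 3 + 2)) * 8))).
  by rewrite -expnM leq_pexp2l //; lia.
by rewrite expnM -[(K ^ 8) ^ K]expnM [8 * K]mulnC expnM leq_exp2rW.
Qed.

Lemma leq_mul_expN d a e c b f :
  N.leb (N.mul (N.of_nat d) (N.pow (N.of_nat a) (N.of_nat e)))
        (N.mul (N.of_nat c) (N.pow (N.of_nat b) (N.of_nat f))) ->
  d * a ^ e <= c * b ^ f.
Proof. by rewrite -!expNE; lia. Qed.

Lemma leq_expN a e c b f :
  N.leb (N.pow (N.of_nat a) (N.of_nat e))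
        (N.mul (N.of_nat c) (N.pow (N.of_nat b) (N.of_nat f))) ->
  a ^ e <= c * b ^ f.
Proof. by rewrite -!expNE; lia. Qed.

(** Takes a [d]-th root in a setting where [A] is only controlled through its [d]-th power. *)
Lemma ltn_mul_exp d A p r u : 0 < d -> 0 < r -> A ^ d <= u ->
  u * p ^ d <= r ^ d -> 4 * A * p < 9 * r.
Proof.
move=> d0 r0 hA hu; rewrite -(@ltn_exp2r _ _ d) // !expnMn -mulnA.
apply: (@leq_ltn_trans (4 ^ d * r ^ d)).
  rewrite leq_mul2l; apply/orP; right; apply: leq_trans hu.
  by rewrite leq_mul2r hA orbT.
by rewrite ltn_mul2r expn_gt0 r0 ltn_exp2r.
Qed.

Lemma expn_succ_le a c e j : 0 < a <= j -> a.+1 ^ e <= c * a ^ e ->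
  j.+1 ^ e <= c * j ^ e.
Proof.
move=> /andP[a0 leaj] h; have p0 : 0 < a ^ e by rewrite expn_gt0 a0.
rewrite -(leq_pmul2l p0) -expnMn.
apply: (@leq_trans ((a.+1 * j) ^ e)); first by apply: leq_exp2rW; lia.
by rewrite expnMn mulnCA mulnA leq_mul2r h orbT.
Qed.

(** A linear bound on a logarithm: log2 (s + 1) <= (180 + s) / 40. *)
Lemma exp40_le s : 64 <= s -> s.+1 ^ 40 <= 2 ^ (180 + s).
Proof.
elim: s => [//|s IHs]; rewrite leq_eqVlt => /predU1P[<-|lt64].
  have -> : 180 + 64 = 244 by [].
  by rewrite -[X in _ <= X]mul1n; apply: leq_expN.
have hs : 0 < 65 <= s.+1 by lia.
rewrite addnS [2 ^ _]expnS; apply: (@leq_trans (2 * s.+1 ^ 40)).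
  by apply: (@expn_succ_le 65 2 40 s.+1 hs); apply: leq_expN.
by rewrite leq_mul2l IHs.
Qed.

Lemma exp5_le q : 4 <= q -> q.+1 ^ 5 <= 2 ^ (3 * q).
Proof.
elim: q => [//|q IHq]; rewrite leq_eqVlt => /predU1P[<-|lt4].
  by rewrite -[X in _ <= X]mul1n; apply: leq_expN.
have hq : 0 < 5 <= q.+1 by lia.
rewrite mulnS [2 ^ _]expnD; apply: (@leq_trans (8 * q.+1 ^ 5)).
  by apply: (@expn_succ_le 5 8 5 q.+1 hq); apply: leq_expN.
by rewrite leq_mul2l IHq.
Qed.

(** The coefficient grows like (27/4) ^ w, so failure would force (27/16) ^ w below about n ^ (e +
    1). But 27/16 exceeds 2 ^ (3/4), while [exp40_le] bounds log2 n linearly in [s]; fortieth powers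
    clear the fractional exponents. *)
Lemma bin_3n_exp_lt w s n e : 64 <= s -> s ^ 2 <= n < s.+1 ^ 2 ->
  1365 <= w -> 3 * w <= n <= 8 * w + 2 -> 96 * e.+1 <= 1440 + 35 * s ->
  n ^ e * 4 ^ w < 'C(3 * w, w).
Proof.
move=> s64 /andP[les lts] w0 /andP[le3w len] he; rewrite ltnNge; apply/negP => h.
case: w w0 le3w len h => // w w0 le3w len h.
have {h}h : 9 * 27 ^ w <= 4 * n ^ e.+1 * 16 ^ w.
  have := bin_3n_ge w; set c := 'C(_, _) in h * => h'.
  have h1 : 3 * (w.+1 * 4 ^ w * c) <= 3 * (w.+1 * 4 ^ w * (n ^ e * 4 ^ w.+1)).
    by rewrite !leq_mul2l h !orbT.
  have h2 : 3 * w.+1 * (4 ^ w * (n ^ e * 4 ^ w.+1))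
            <= n * (4 ^ w * (n ^ e * 4 ^ w.+1)) by rewrite leq_mul2r le3w orbT.
  have -> : 16 ^ w = 4 ^ w * 4 ^ w by rewrite -expnMn.
  by move: h' h1 h2; rewrite !expnS; lia.
have hn : n ^ 40 <= 2 ^ (2 * (180 + s)).
  rewrite mulnC expnM; apply: (@leq_trans ((s.+1 ^ 40) ^ 2)).
    by rewrite -expnM mulnC expnM leq_exp2r // ltnW.
  by rewrite leq_exp2r // exp40_le.
have h27 : 2 ^ (30 * w) * 16 ^ (40 * w) <= 27 ^ (40 * w).
  rewrite [in 2 ^ _](_ : 30 * w = 3 * (10 * w)); last by lia.
  rewrite (_ : 40 * w = 4 * (10 * w)); last by lia.
  rewrite !(expnM _ _ (10 * w)) -expnMn; apply: leq_exp2rW.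
  by rewrite -[X in _ <= X]mul1n; apply: leq_mul_expN.
have expo : 2 * (180 + s) * e.+1 <= 30 * w.
  (* For small [s] the bound 1365 on the original [w] suffices; for large [s] that [w] is at least
     about s ^ 2 / 8. *)
  have [s104|s104] := leqP s 104; nia.
have {hn}hn : n ^ (40 * e.+1) <= 2 ^ (30 * w).
  rewrite expnM; apply: leq_trans (leq_exp2rW _ hn) _.
  by rewrite -expnM leq_pexp2l.
move: h; rewrite leqNgt => /negP; apply.
apply: (@ltn_mul_exp 40 _ _ _ (2 ^ (30 * w))) => //.
- by rewrite expn_gt0.
- by rewrite -expnM mulnC.
- by rewrite -![(_ ^ w) ^ 40]expnM ![w * 40]mulnC.
Qed.

(** From s ^ 10 <= n ^ 5 <= K ^ 8 comes s ^ (5/4) <= K, so s * q <= K for the integer fourth root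
    [q] of [s]. Then s + 1 <= (q + 1) ^ 4 and [exp5_le] conclude. Up to 400, the bound 401 <= 2 ^ 9
    and 9 * 160 = 1440 do. *)
Lemma exp_sqrt_le K n s e : 1440 <= K -> n ^ 5 <= K ^ 8 -> s ^ 2 <= n ->
  (400 < s -> 12 * e <= 5 * s) -> (s <= 400 -> e <= 160) ->
  s.+1 ^ e <= 2 ^ K.
Proof.
move=> K0 hn les big small; have [lt400|le400] := ltnP 400 s; last first.
  apply: (@leq_trans ((2 ^ 9) ^ e)); last first.
    by rewrite -expnM leq_pexp2l //; have := small le400; lia.
  by apply: leq_exp2rW; apply: (@leq_trans 401).
have {big small}he := big lt400.
have [q /andP[leq ltq]] := exists_root s (isT : 0 < 4).
have q4 : 4 <= q.
  by rewrite -ltnS -(@ltn_exp2r _ _ 4) //; apply: leq_ltn_trans ltq; lia.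
have leK : s * q <= K.
  rewrite -(@leq_exp2r _ _ 4) //.
  apply: (@leq_trans (s ^ 5)).
    by rewrite expnMn (expnSr s 4) leq_mul2l leq orbT.
  rewrite -(@leq_exp2r _ _ 2) // -!expnM (_ : 4 * 2 = 8) //.
  apply: leq_trans hn; rewrite (_ : 5 * 2 = 2 * 5) // expnM.
  by rewrite leq_exp2r.
rewrite -(@leq_exp2r _ _ 5) // -!expnM.
apply: (@leq_trans (q.+1 ^ (5 * (4 * e)))).
  rewrite (_ : 5 * (4 * e) = 4 * (e * 5)); last by lia.
  by rewrite [q.+1 ^ _]expnM; apply: leq_exp2rW.
rewrite expnM; apply: leq_trans (leq_exp2rW _ (exp5_le q4)) _.
by rewrite -expnM leq_pexp2l //; nia.
Qed.

(** Since n / (3K) is at least 8/3, the coefficient is about (27/4 * 8/3) ^ K = 18 ^ K, whereas n ^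
    (e + 1) * 4 ^ K is at most 16 ^ K. The spare factor [n] pays for the polynomial loss. *)
Lemma bin_exp_lt K n s e : 1440 <= K -> n ^ 5 <= K ^ 8 ->
  s ^ 2 <= n < s.+1 ^ 2 -> 8 * K <= n ->
  (400 < s -> 12 * e.+1 <= 5 * s) -> (s <= 400 -> e.+1 <= 160) ->
  n ^ e * 4 ^ K < 'C(n, K).
Proof.
move=> K0 hn /andP[les lts] leKn big small; rewrite ltnNge; apply/negP => h.
have le3 : 3 * K <= n by lia.
have h1 : n ^ e.+1 <= 4 ^ K.
  apply: (@leq_trans ((s.+1 ^ e.+1) ^ 2)).
    by rewrite -expnM [e.+1 * 2]mulnC expnM; apply/leq_exp2rW/ltnW.
  rewrite (_ : 4 ^ K = (2 ^ K) ^ 2); last by rewrite -expnM mulnC expnM.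
  by rewrite leq_exp2r // (@exp_sqrt_le K n).
have h2 := bin_ratio_expn le3 (leqnn K).
have {h}h2 : 'C(3 * K, K) * 8 ^ K <= n ^ e * 4 ^ K * 3 ^ K.
  have p0 : 0 < K ^ K by rewrite expn_gt0; lia.
  rewrite -(leq_pmul2r p0) -[X in X <= _]mulnA -expnMn.
  apply: (@leq_trans ('C(3 * K, K) * n ^ K)).
    by rewrite leq_mul2l; apply/orP; right; apply: leq_exp2rW.
  by apply: leq_trans h2 _; rewrite expnMn mulnA !leq_mul2r h ?orbT.
case: K K0 leKn h1 h2 {hn le3} => // K K0 leKn h1 h2.
have h3 := bin_3n_ge K; move: h2 h3; set c := 'C(_, _) => h2 h3.
have h4 : 3 * 27 ^ K * 8 ^ K.+1 <= K.+1 * 4 ^ K * (n ^ e * 4 ^ K.+1 * 3 ^ K.+1).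
  apply: (@leq_trans (K.+1 * 4 ^ K * c * 8 ^ K.+1)).
    by rewrite leq_mul2r h3 orbT.
  by rewrite -mulnA leq_mul2l h2 orbT.
have h5 : 8 * (3 * 27 ^ K * 8 ^ K.+1) <= 4 ^ K * 4 ^ K.+1 * (4 ^ K.+1 * 3 ^ K.+1).
  have q1 : 8 * (3 * 27 ^ K * 8 ^ K.+1)
    <= 8 * (K.+1 * 4 ^ K * (n ^ e * 4 ^ K.+1 * 3 ^ K.+1)) by rewrite leq_mul2l h4.
  have q2 : 8 * K.+1 * (n ^ e * (4 ^ K * 4 ^ K.+1 * 3 ^ K.+1))
    <= n * (n ^ e * (4 ^ K * 4 ^ K.+1 * 3 ^ K.+1)) by rewrite leq_mul2r leKn orbT.
  have q3 : n ^ e.+1 * (4 ^ K * 4 ^ K.+1 * 3 ^ K.+1)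
    <= 4 ^ K.+1 * (4 ^ K * 4 ^ K.+1 * 3 ^ K.+1) by rewrite leq_mul2r h1 orbT.
  apply: leq_trans q1 _; apply: leq_trans (_ : _ <= _) (leq_trans q3 _).
    by apply: leq_trans (leq_trans q2 _); rewrite ?expnS; lia.
  by lia.
have e1 : 27 ^ K * 8 ^ K = 216 ^ K by rewrite -expnMn.
have e2 : 4 ^ K * 4 ^ K * (4 ^ K * 3 ^ K) = 192 ^ K by rewrite -!expnMn.
have : 192 ^ K <= 216 ^ K by rewrite leq_exp2rW.
have : 0 < 192 ^ K by rewrite expn_gt0.
by move: h5; rewrite !expnS -e1 -e2; lia.
Qed.

Definition smooth_interval (u v y : nat) :=
  forall p t, prime p -> u < t <= v -> p %| t -> p <= y.

Lemma smooth_interval_bin n K y : K <= n -> smooth_interval (n - K) n y ->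
  forall p, prime p -> p %| 'C(n, K) -> p <= y.
Proof.
move=> leKn smooth p pp pC.
have : p %| n ^_ K by rewrite -bin_ffact dvdn_mulr.
by case/(prime_dvd_ffact pp leKn) => t ht pt; apply: (smooth _ t).
Qed.

Lemma leq_bin_half n w K : w <= K -> 2 * K <= n -> 'C(n, w) <= 'C(n, K).
Proof.
move/subnK <-; elim: (K - w) => [//|j IHj] leKn.
apply: leq_trans (IHj _) _; first by lia.
rewrite addSn -(@leq_pmul2l (j + w).+1) // mul_bin_left leq_mul2r.
by apply/orP; right; lia.
Qed.

(** The first bound keeps [x] far below [m]. The second reads 32(2t + 3) <= 352 + 2 ^ (t + 1), with
    equality at [t = 5], and bounds [x] in terms of sqrt n. *)
Lemma log4_bounds t : 5 <= t -> 200 * t <= 4 ^ t /\ 64 * t + 96 <= 352 + 2 ^ t.+1.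
Proof.
elim: t => [//|t IHt]; rewrite leq_eqVlt => /predU1P[<-|t5]; first by split.
have [h1 h2] := IHt t5; rewrite [4 ^ _]expnS [2 ^ t.+2]expnS.
have : 2 ^ 6 <= 2 ^ t.+1 by rewrite leq_exp2l.
by split; lia.
Qed.

Lemma no_smooth_large m M x : 1024 <= m <= M -> 'C(2 * m + x, m) < 4 ^ m ->
  ~ smooth_interval (2 * M + 2 * x) (2 * (m + M)) (2 * m + x).
Proof.
move=> /andP[m0 lemM] hx smooth.
have m1 : 0 < m by lia.
set t := trunc_log 4 m.
have let_ : 4 ^ t <= m by apply: trunc_logP.
have ltt : m < 4 ^ t.+1 by apply: trunc_log_ltn.
have t5 : 5 <= t by apply: trunc_log_max.
have hxt : x <= 2 * t + 3 by apply: (x_le_log _ _ hx); [lia | rewrite let_].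
have [h1 h2] := log4_bounds t5.
set n := 2 * (m + M) in smooth *; set K := 2 * m - 2 * x; set y := 2 * m + x.
have le2K : 2 * K <= n by lia.
have def_u : n - K = 2 * M + 2 * x by lia.
have leKn : K <= n by lia.
move: smooth; rewrite -def_u => /(smooth_interval_bin leKn) smooth.
have hnK : n ^ 5 <= K ^ 8 by apply: (@smooth_bin_pow n K y) => //; lia.
have [s /andP[les lts]] := exists_root n (isT : 0 < 2).
have hs2 : 2 ^ t.+1 <= s.
  rewrite -ltnS -(@ltn_exp2r _ _ 2) //; apply: leq_ltn_trans lts.
  have -> : (2 ^ t.+1) ^ 2 = 4 * 4 ^ t by rewrite -expnM mulnC expnM -expnS.
  by lia.
have hxs : 32 * x <= 352 + s by lia.
have s64 : 64 <= s.
  by apply: leq_trans hs2; rewrite (@leq_exp2l 2 6).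
have lesK : s <= K.
  rewrite -(@leq_exp2r _ _ 8) //; apply: leq_trans hnK.
  apply: (@leq_trans (s ^ (2 * 5))); first by rewrite leq_pexp2l //; lia.
  by rewrite expnM; apply: leq_exp2rW.
set e := s %/ 3 + 2 + ((y - K) %/ 3 + 1).
have he3 : 3 * e <= s + 9 + 3 * x by rewrite /e; lia.
(* Combine 32 times [he3] with 3 times [hxs]: the constant is 96 + 288 + 1056 = 1440. *)
have he : 96 * e.+1 <= 1440 + 35 * s by lia.
have big : 400 < s -> 12 * e.+1 <= 5 * s by lia.
have small : s <= 400 -> e.+1 <= 160 by lia.
have K1440 : 1440 <= K by lia.
have n4096 : 4096 <= n by lia.
have leKy : K <= y by lia.
have les_lts : s ^ 2 <= n < s.+1 ^ 2 by rewrite les.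
suff [w [w3 hw hlt]] : exists w, [/\ 3 <= w <= K, w < K -> n < 3 * w.+1
    & n ^ e * 4 ^ w < 'C(n, K)].
  have := bin_le_primorial le2K leKy (leq_trans lesK leKy) w3 hw lts smooth.
  by rewrite leqNgt hlt.
clear - s64 les_lts hnK he big small K1440 n4096 le2K.
move: n K e les_lts hnK he big small K1440 n4096 le2K.
move=> n K e hs hnK he big small K1440 n4096 le2K.
(* Three regimes: [w = K] with [8 * K <= n], [w = K] with [n] between 3K and 8K, and otherwise [w]
   the integer part of n / 3, at least 1365 because [n >= 4096]. *)
have [le3K|lt3K] := leqP (3 * K) n.
  exists K; split; [lia|lia|].
  have [le8|lt8] := leqP (8 * K) n; first exact: (bin_exp_lt K1440 hnK hs le8).
  apply: leq_trans (leq_bin2l K le3K).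
  apply: (bin_3n_exp_lt s64 hs _ _ he); first by lia.
  by rewrite le3K /=; lia.
have [w hw] : exists w, 3 * w <= n < 3 * w.+1 by exists (n %/ 3); lia.
exists w; split; [lia|lia|].
have [leKw le3 w1365] : [/\ w <= K, 3 * w <= n & 1365 <= w] by split; lia.
apply: (leq_trans _ (leq_bin_half leKw le2K)).
apply: leq_trans (leq_bin2l w le3).
by apply: (bin_3n_exp_lt s64 hs w1365 _ he); rewrite le3 /=; lia.
Qed.

(** * A table of primes *)

Fixpoint no_divisorN (fuel : nat) (d p : N) : bool :=
  if fuel is f.+1 then
    N.ltb p (d * d) || (~~ N.eqb (N.modulo p d) 0 && no_divisorN f (N.succ d) p)
  else false.

(** Trial division from 2. The fuel suffices for the largest table entry 200609 < 448 ^ 2; exhausted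
    fuel answers [false], so a positive answer is always sound. *)
Definition primeN (p : N) : bool := N.ltb 1 p && no_divisorN 450 2 p.

Lemma no_divisorN_lt fuel d p e : no_divisorN fuel (N.of_nat d) (N.of_nat p) ->
  d <= e -> e %| p -> p < e * e.
Proof.
elim: fuel d => [//|f IHf] d /= /orP[h lede _|/andP[nd h] lede ep]; first by nia.
have [eq_de|ltde] := eqVneq d e; last first.
  by apply: (IHf d.+1) => //; [rewrite Nat2N.inj_succ|lia].
case/negP: nd; case/dvdnP: ep => c ->; rewrite eq_de Nat2N.inj_mul.
apply/N.eqb_spec/N.Div0.mod_mul.
Qed.

Lemma primeNP p : primeN (N.of_nat p) -> prime p.
Proof.
move=> /andP[p1 h]; have lt1p : 1 < p by lia.
apply: ltn_pdiv2_prime; first by lia.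
rewrite -mulnn; apply: (@no_divisorN_lt 450 2) (pdiv_dvd p) => //.
by rewrite prime_gt1 // pdiv_prime.
Qed.

(** The window lengths guaranteed in [no_smooth_medium]: 2 * 9 - 4, 2 * 14 - 8 and 2 * 76 - 8. *)
Definition gap_bound (p : N) : N :=
  (if N.ltb p 500 then 14 else if N.ltb p 1000 then 20 else 144)%num.

(** A longer gap is admissible when its eighth power is at most [p ^ 5], matching the inequality
    [n ^ 5 <= K ^ 8] of [smooth_bin_pow]. *)
Definition small_gap (p q : N) : bool :=
  N.leb q (p + gap_bound p)
  || N.leb 1000 p && N.ltb p q && N.leb ((q - p) ^ 8) (p ^ 5).

(** A sparse chain of primes, as the gaps allow. It ends where [n ^ 5] exceeds 2047 ^ 8, the largest
    possible [K ^ 8]. *)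
Definition prime_table : seq N := [::
31; 43; 53; 67; 79; 89; 103; 113; 127; 139; 151; 163; 173; 181; 193; 
199; 211; 223; 233; 241; 251; 263; 277; 283; 293; 307; 317; 331; 337; 349; 
359; 373; 383; 397; 409; 421; 433; 443; 457; 467; 479; 491; 503; 523; 541; 
557; 577; 593; 613; 631; 647; 661; 677; 691; 709; 727; 743; 761; 773; 787; 
797; 811; 829; 839; 859; 877; 887; 907; 919; 937; 953; 971; 991; 1009; 
1153; 1297; 1439; 1583; 1723; 1867; 2011; 2153; 2297; 2441; 2579; 2719; 
2861; 3001; 3137; 3271; 3413; 3571; 3733; 3889; 4057; 4231; 4409; 4597; 
4789; 4987; 5189; 5393; 5591; 5807; 6029; 6257; 6491; 6719; 6961; 7213; 
7459; 7717; 7963; 8237; 8513; 8783; 9067; 9349; 9649; 9949; 10259; 10567; 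
10891; 11213; 11551; 11897; 12241; 12589; 12953; 13313; 13691; 14071; 
14461; 14851; 15241; 15649; 16067; 16487; 16903; 17341; 17783; 18233; 
18691; 19157; 19609; 20089; 20563; 21059; 21559; 22067; 22573; 23099; 
23629; 24169; 24709; 25261; 25819; 26387; 26959; 27541; 28123; 28723; 
29333; 29947; 30559; 31193; 31817; 32467; 33119; 33773; 34439; 35117; 
35809; 36497; 37201; 37907; 38629; 39359; 40099; 40849; 41611; 42379; 
43151; 43933; 44729; 45533; 46337; 47161; 47981; 48823; 49669; 50527; 
51383; 52259; 53147; 54037; 54941; 55849; 56773; 57709; 58631; 59581; 
60539; 61511; 62483; 63473; 64453; 65449; 66467; 67499; 68539; 69557; 
70619; 71671; 72739; 73823; 74923; 76031; 77153; 78283; 79427; 80567; 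
81727; 82891; 84067; 85259; 86461; 87671; 88897; 90127; 91373; 92627; 
93893; 95153; 96443; 97729; 99041; 100363; 101693; 103007; 104347; 105701; 
107077; 108463; 109859; 111271; 112691; 114113; 115561; 117017; 118471; 
119953; 121447; 122939; 124447; 125963; 127493; 129037; 130589; 132157; 
133733; 135329; 136897; 138517; 140143; 141773; 143419; 145069; 146749; 
148439; 150131; 151849; 153563; 155303; 157057; 158803; 160583; 162359; 
164149; 165961; 167779; 169607; 171449; 173309; 175141; 177019; 178921; 
180811; 182713; 184651; 186601; 188563; 190543; 192529; 194527; 196543; 
198571; 200609]%num.

Lemma prime_table_ok :
  [&& primeN 17%num, all primeN prime_table & path small_gap 17%num prime_table].
Proof. by vm_cast_no_check (erefl true). Qed.

Lemma path_cover (r : rel N) (a : pred N) x s n : path r x s -> a x -> all a s ->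
  (x <= n < last x s)%num ->
  exists p q, [/\ a p, r p q & (p <= n < q)%num].
Proof.
elim: s x => [|y s IHs] x /=; first by move=> _ _ _; lia.
move=> /andP[rxy ps] ax /andP[ay as_] hn.
have [lexy|ltyn] := N.lt_ge_cases n y; first by exists x, y; split => //; lia.
by apply: (IHs y) => //; lia.
Qed.

(** If [n] lies between table neighbours [p <= n < q] and [q - p <= K], then [p] lies in the
    window. *)
Lemma prime_in_window n K : 17 <= n -> 14 <= K <= 2047 ->
  (500 <= n -> 20 <= K) -> (1000 <= n -> 144 <= K /\ n ^ 5 <= K ^ 8) ->
  exists2 p, prime p & n - K < p <= n.
Proof.
move=> n17 hK h500 h1000.
have expo : 1000 <= n -> (N.of_nat n ^ 5 <= N.of_nat K ^ 8)%num.
  by case/h1000 => _ /leP; rewrite -(expNE n 5) -(expNE K 8); lia.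
have nmax : (N.of_nat n < 200609)%num.
  apply/N.nle_gt => len; have n1000 : 1000 <= n by lia.
  have {}expo := expo n1000.
  have l1 : (200609 ^ 5 <= N.of_nat n ^ 5)%num by apply: N.pow_le_mono_l; lia.
  have l2 : (N.of_nat K ^ 8 <= 2047 ^ 8)%num by apply: N.pow_le_mono_l; lia.
  have l3 : (2047 ^ 8 < 200609 ^ 5)%num by [].
  by lia.
have lst : last 17%num prime_table = 200609%num by [].
have /and3P[a0 a1 gaps] := prime_table_ok.
have [|p [q [pp gap [lep ltq]]]] := path_cover (n := N.of_nat n) gaps a0 a1.
  by rewrite lst; lia.
have {lst gaps a0 a1}pr : prime (N.to_nat p) by apply: primeNP; rewrite N2Nat.id.
have p0 := prime_gt0 pr; exists (N.to_nat p); first exact: pr.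
suff : N.to_nat q - N.to_nat p <= K by clear gap; lia.
case/orP: gap => [|/andP[/andP[p1000 ltpq] h8]].
  by rewrite /gap_bound; do !case: ifP; lia.
have n1000 : 1000 <= n by lia.
have l1 : (p ^ 5 <= N.of_nat n ^ 5)%num by apply: N.pow_le_mono_l; lia.
have [//|gtK] := leqP (N.to_nat q - N.to_nat p) K.
have : (N.of_nat K ^ 8 < (q - p) ^ 8)%num by apply: N.pow_lt_mono_l; lia.
by have := expo n1000; lia.
Qed.

(** * Small parameters *)

Definition exp_lt_binN (n e K : nat) : bool :=
  N.ltb (N.pow (N.of_nat n) (N.of_nat e) * ffactN (N.of_nat K) K)
        (ffactN (N.of_nat n) K).

Lemma exp_lt_binNP n e K : exp_lt_binN n e K -> n ^ e < 'C(n, K).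
Proof.
rewrite /exp_lt_binN -!ffactNE ffactnn -expNE => h.
by rewrite -(@ltn_pmul2r K`!) ?fact_gt0 // bin_ffact; lia.
Qed.

(** Smoothness gives C(n, K) <= n ^ e, and C(n, K) / n ^ e does not decrease in [n] as [e <= K]; so
    one check at [n0] excludes every [n >= n0]. *)
Lemma smooth_interval_lt n0 n K y e : 0 < n0 -> K <= n -> e <= K ->
  \sum_(0 <= p < y.+1 | prime p) 1 <= e -> exp_lt_binN n0 e K ->
  smooth_interval (n - K) n y -> n < n0.
Proof.
move=> n00 leKn leeK hy /exp_lt_binNP hC smooth.
rewrite ltnNge; apply/negP => len0.
have n1 : 0 < n by lia.
have hn : 'C(n, K) <= n ^ e.
  apply: leq_trans (bin_le_exp_count n1 leKn (smooth_interval_bin leKn smooth)) _.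
  by rewrite leq_pexp2l.
have h := bin_ratio_expn len0 leeK.
have {h}: n ^ e * n0 ^ e < n ^ e * n0 ^ e.
  apply: (@leq_trans ('C(n0, K) * n ^ e)).
    by rewrite mulnC ltn_pmul2r // expn_gt0 n1.
  by apply: leq_trans h _; rewrite leq_mul2r hn orbT.
by rewrite ltnn.
Qed.

Lemma no_smooth_window n K y : 17 <= n -> 14 <= K <= 2047 -> y <= n - K ->
  (500 <= n -> 20 <= K) -> (1000 <= n -> 144 <= K /\ n ^ 5 <= K ^ 8) ->
  ~ smooth_interval (n - K) n y.
Proof.
move=> n17 hK hy h500 h1000 smooth.
have [p pp hp] := prime_in_window n17 hK h500 h1000.
by have := smooth p p pp hp (dvdnn p); lia.
Qed.

Lemma smooth_checks_14 :
  all (fun m => exp_lt_binN 1000 ((2 * m + 4) %/ 3 + 2) (2 * m - 8)) (iota 14 62).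
Proof. by vm_cast_no_check (erefl true). Qed.

Lemma smooth_checks_9 :
  all (fun m => exp_lt_binN 500 ((2 * m + 2) %/ 3 + 2) (2 * m - 4)) (iota 9 5).
Proof. by vm_cast_no_check (erefl true). Qed.

Lemma no_smooth_medium m M x : 9 <= m <= M -> m < 1024 ->
  'C(2 * m + x, m) < 4 ^ m ->
  ~ smooth_interval (2 * M + 2 * x) (2 * (m + M)) (2 * m + x).
Proof.
move=> /andP[m9 lemM] m1024 hx smooth.
set n := 2 * (m + M) in smooth.
(* In each range the window ending at [n] contains a prime, which exceeds the smoothness bound. For
   small [m], [x] is first replaced by its upper bound so that a finite check limits [n]. *)
have [le13|lt13] := leqP m 13.
  have x2 : x <= 2 by apply: x_le2 hx; lia.
  have {smooth}smooth : smooth_interval (n - (2 * m - 4)) n (2 * m + 2).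
    by move=> p t pp ht pt; have := smooth p t pp _ pt; lia.
  have hn : n < 500.
    apply: (smooth_interval_lt _ _ _ (count_prime_le _) _ smooth); try lia.
    by apply: (allP smooth_checks_9); rewrite mem_iota; lia.
  by apply: no_smooth_window smooth; lia.
have [le75|lt75] := leqP m 75.
  have x4 : x <= 4 by apply: x_le4 hx; lia.
  have {smooth}smooth : smooth_interval (n - (2 * m - 8)) n (2 * m + 4).
    by move=> p t pp ht pt; have := smooth p t pp _ pt; lia.
  have hn : n < 1000.
    apply: (smooth_interval_lt _ _ _ (count_prime_le _) _ smooth); try lia.
    by apply: (allP smooth_checks_14); rewrite mem_iota; lia.
  by apply: no_smooth_window smooth; lia.
have hx' : x <= 4 \/ x <= 11 /\ 256 <= m.
  have [le255|lt255] := leqP m 255.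
    by left; apply: x_le4 hx; lia.
  (* With 4 ^ 4 <= m < 4 ^ 5 the bound is 2 * 4 + 3 = 11. *)
  right; split=> //; apply: (@x_le_log m x 4) hx => //; lia.
have leKn : 2 * m - 2 * x <= n by lia.
have {}smooth : smooth_interval (n - (2 * m - 2 * x)) n (2 * m + x).
  by move=> p t pp ht pt; have := smooth p t pp _ pt; lia.
have := no_smooth_window _ _ _ _ _ smooth; apply; try lia.
move=> n1000; split; first by lia.
(* The hypothesis 8y + 48 <= 9K amounts to 13x + 24 <= m, which for [x = 4] starts exactly at
   [m = 76]. *)
by apply: smooth_bin_pow (smooth_interval_bin leKn smooth); lia.
Qed.

Lemma no_smooth m M x : 9 <= m <= M -> 'C(2 * m + x, m) < 4 ^ m ->
  ~ smooth_interval (2 * M + 2 * x) (2 * (m + M)) (2 * m + x).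
Proof.
move=> /andP[m9 lemM] hx; have [lt|le] := ltnP m 1024.
  by apply: no_smooth_medium; rewrite ?m9.
by apply: no_smooth_large; rewrite ?le.
Qed.

Lemma x_le_m m x : 2 <= m -> 'C(2 * m + x, m) < 4 ^ m -> x <= m.
Proof.
move=> m2 hx; have [le13|lt13] := leqP m 13.
  by have : x <= 2 by [apply: x_le2 hx; lia]; lia.
have [le255|lt255] := leqP m 255.
  by have : x <= 4 by [apply: x_le4 hx; lia]; lia.
have m0 : 0 < m by lia.
set t := trunc_log 4 m.
have let_ : 4 ^ t <= m by apply: trunc_logP.
have ltt : m < 4 ^ t.+1 by apply: trunc_log_ltn.
have t4 : 4 <= t by apply: trunc_log_max.
have hxt : x <= 2 * t + 3 by apply: (x_le_log _ _ hx); [lia | rewrite let_].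
apply: leq_trans hxt _; apply: leq_trans let_.
by elim: {ltt} t t4 => // t IHt; rewrite leq_eqVlt => /predU1P[<-//|/IHt];
   rewrite expnS; lia.
Qed.

(** The cancelled equation of [equation_ffact_l] for [x = 2], the only value left when the smaller
    parameter is at most 8; [equation_rN] does the same for [equation_ffact_r]. *)
Definition equation_lN (a b : nat) : bool :=
  N.eqb (ffactN (N.of_nat (2 * (a + b))) (2 * a - 2)
         * ffactN (N.of_nat a) a ^ 2)
        (ffactN (N.of_nat (2 * a)) (2 * a) * ffactN (N.of_nat (a + b)) a
         * ffactN (N.of_nat (a + b)) (a - 2)).

Definition equation_rN (a b : nat) : bool :=
  N.eqb (ffactN (N.of_nat (2 * (a + b))) (2 * b) * ffactN (N.of_nat b) b
         * ffactN (N.of_nat (2 + b)) (2 + b))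
        (ffactN (N.of_nat (a + b)) b ^ 2
         * ffactN (N.of_nat (2 + 2 * b)) (2 + 2 * b)).

Lemma equation_checks_l :
  all (fun a => all (fun b => ~~ equation_lN a b) (iota 1 99)) (iota 5 4).
Proof. by vm_cast_no_check (erefl true). Qed.

Lemma equation_checks_r :
  all (fun b => all (fun a => ~~ equation_rN a b) (iota 1 99)) (iota 2 7).
Proof. by vm_cast_no_check (erefl true). Qed.

(** The estimate y/3 + 2 is replaced by exact prime counts, and the sharper bound [2 * a] of
    [smooth_l] is used. *)
Lemma smooth_checks_l :
  all (fun a => let e := count prime (iota 0 (2 * a).+1) in
         (e <= 2 * a - 4) && exp_lt_binN 200 e (2 * a - 4)) (iota 5 4).
Proof. by vm_cast_no_check (erefl true). Qed.

Lemma smooth_checks_r :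
  all (fun b => let e := count prime (iota 0 (2 * b + 2).+1) in
         (e <= 2 * b) && exp_lt_binN 200 e (2 * b)) (iota 2 7).
Proof. by vm_cast_no_check (erefl true). Qed.

Lemma sum_prime_count y :
  \sum_(0 <= p < y.+1 | prime p) 1 = count prime (iota 0 y.+1).
Proof. by rewrite sum1_count /index_iota subn0. Qed.

Lemma no_small_r a b : 2 <= b <= 8 -> b <= a ->
  'C(2 * (a + b), a + b) <> 'C(2 * a, a) * 'C(2 + 2 * b, b).
Proof.
move=> hb leba E.
have smooth : smooth_interval (2 * (a + b) - 2 * b) (2 * (a + b)) (2 * b + 2).
  by move=> p t pp ht pt; apply: smooth_r E pp _ pt; lia.
have hk : 2 * (a + b) < 200.
  have bI : b \in iota 2 7 by rewrite mem_iota; lia.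
  have /andP[le_e chk] := allP smooth_checks_r b bI.
  by apply: (smooth_interval_lt _ _ le_e _ chk smooth);
    rewrite ?sum_prime_count; lia.
have /allP/(_ b)/(_ _)/allP/(_ a)/(_ _)/negP := equation_checks_r.
rewrite !mem_iota; apply; [lia|lia|].
have := equation_ffact_r E; rewrite -!ffactnn => e.
by apply/N.eqb_spec; rewrite -!ffactNE; lia.
Qed.

Lemma no_small_l a b : 2 <= a <= 8 -> 0 < b -> a <= b ->
  'C(2 * (a + b), a + b) <> 'C(2 * a, a) * 'C(2 + 2 * b, b).
Proof.
move=> ha b0 leab E.
have lexa : 2 <= a by lia.
have ef := equation_ffact_l lexa E.
(* For [a <= 4] the window length 2a - 4 does not exceed the number of primes up to 2a, so the size
   argument fails; the cancelled equation is then a polynomial one in [b]. *)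
have [le5|lt5] := leqP 5 a; last first.
  have {ha lt5 lexa leab E} : a = 2 \/ a = 3 \/ a = 4 by lia.
  case: b b0 ef => // b _ ef [|[|]] ea; move: ef; rewrite {a}ea => ef.
  - have : (2 * b).+4.+2 ^_ 2 * 2`! ^ 2 = 4`! * b.+3 ^_ 2 * b.+3 ^_ 0.
      by rewrite -ef; congr (_ ^_ _ * _); lia.
    by rewrite !factS fact0 !ffactnS !ffactn0 /=; nia.
  - have : (2 * b).+4.+4 ^_ 4 * 3`! ^ 2 = 6`! * b.+4 ^_ 3 * b.+4 ^_ 1.
      by rewrite -ef; congr (_ ^_ _ * _); lia.
    by rewrite !factS fact0 !ffactnS !ffactn0 /=; nia.
  - have : (2 * b).+4.+4.+2 ^_ 6 * 4`! ^ 2 = 8`! * b.+4.+1 ^_ 4 * b.+4.+1 ^_ 2.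
      by rewrite -ef; congr (_ ^_ _ * _); lia.
    by rewrite !factS fact0 !ffactnS !ffactn0 /=; nia.
have smooth : smooth_interval (2 * (a + b) - (2 * a - 4)) (2 * (a + b)) (2 * a).
  by move=> p t pp ht pt; apply: smooth_l lexa _ E pp _ pt; lia.
have aI : a \in iota 5 4 by rewrite mem_iota; lia.
have hk : 2 * (a + b) < 200.
  have /andP[le_e chk] := allP smooth_checks_l a aI.
  by apply: (smooth_interval_lt _ _ le_e _ chk smooth);
    rewrite ?sum_prime_count; lia.
have /allP/(_ b)/(_ _)/negP := allP equation_checks_l a aI.
rewrite mem_iota; apply; first by lia.
move: ef; rewrite -!ffactnn => e.
by apply/N.eqb_spec; rewrite -!ffactNE; lia.
Qed.

(** * The theorem *)

Lemma central_succ j :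
  j.+1 * 'C(2 * j.+1, j.+1) = 2 * (2 * j).+1 * 'C(2 * j, j).
Proof.
have := bin_2D_succ j 0; rewrite !addn0 => e.
by apply/eqP; rewrite -(@eqn_pmul2l j.+1) //; apply/eqP; lia.
Qed.

Lemma central_lt M j : 0 < j -> 'C(2 * (M + j), M + j) < 4 ^ j * 'C(2 * M, M).
Proof.
have step i : 'C(2 * i.+1, i.+1) < 4 * 'C(2 * i, i).
  have := central_succ i; have : 0 < 'C(2 * i, i) by rewrite bin_gt0; lia.
  by nia.
case: j => // j _; elim: j => [|j IHj]; first by rewrite addn1 expn1.
rewrite addnS expnS; apply: (ltn_trans (step _)).
by rewrite -mulnA ltn_pmul2l.
Qed.

(** Raising [x] multiplies C(2c + x, c) by (2c + x + 1) / (c + x + 1), which increases with [c].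
    This transfers the bound from [b] to the smaller parameter [a] in [bin_lt_exp4_l]. *)
Lemma bin_2D_cross a b x : a <= b ->
  'C(2 * a + x, a) * 'C(2 * b, b) <= 'C(2 * a, a) * 'C(2 * b + x, b).
Proof.
move=> leab; elim: x => [|x IHx]; first by rewrite !addn0.
have rec c : (c + x).+1 * 'C((2 * c + x).+1, c) = (2 * c + x).+1 * 'C(2 * c + x, c).
  rewrite (mul_bin_down (2 * c + x).+1); congr (_ * _); lia.
rewrite !addnS -(@leq_pmul2l ((a + x).+1 * (b + x).+1)) //.
have := rec a; have := rec b; move: IHx.
set A := 'C(2 * a + x, a); set B := 'C(2 * b, b); set P := 'C(2 * a, a).
set Q := 'C(2 * b + x, b); set A' := 'C(_.+1, a); set B' := 'C(_.+1, b) => h eb ea.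
have -> : (a + x).+1 * (b + x).+1 * (A' * B)
        = (2 * a + x).+1 * (b + x).+1 * (A * B) by rewrite mulnACA ea mulnACA.
have -> : (a + x).+1 * (b + x).+1 * (P * B')
        = (a + x).+1 * (2 * b + x).+1 * (P * Q) by rewrite mulnACA eb mulnACA.
by apply: leq_mul => //; nia.
Qed.

Lemma bin_lt_exp4_r a b x : 0 < b ->
  'C(2 * (a + b), a + b) = 'C(2 * a, a) * 'C(x + 2 * b, b) ->
  'C(2 * b + x, b) < 4 ^ b.
Proof.
move=> b0 E; have := central_lt a b0; rewrite E [x + _]addnC mulnC ltn_pmul2r //.
by rewrite bin_gt0; lia.
Qed.

Lemma bin_lt_exp4_l a b x : 0 < a <= b ->
  'C(2 * (a + b), a + b) = 'C(2 * a, a) * 'C(x + 2 * b, b) ->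
  'C(2 * a + x, a) < 4 ^ a.
Proof.
move=> /andP[a0 leab] E.
have C0 : 0 < 'C(2 * b, b) by rewrite bin_gt0; lia.
rewrite -(ltn_pmul2r C0); apply: leq_ltn_trans (bin_2D_cross x leab) _.
by rewrite [2 * b + x]addnC -E addnC; apply: central_lt.
Qed.

Lemma ltn_bin2l n N K : 0 < K <= n.+1 -> n < N -> 'C(n, K) < 'C(N, K).
Proof.
case: K => // K leKn ltnN; apply: leq_trans (leq_bin2l K.+1 ltnN).
by rewrite binS -addn1 leq_add2l bin_gt0.
Qed.

Lemma central_double b : 'C(2 * (1 + b), 1 + b) = 2 * 'C(1 + 2 * b, b).
Proof.
have -> : 2 * (1 + b) = (1 + 2 * b).+1 by lia.
have sub : b <= 1 + 2 * b by lia.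
have := bin_sub sub; rewrite (_ : 1 + 2 * b - b = b.+1); last by lia.
by rewrite [1 + b]add1n binS => ->; rewrite addnn -mul2n.
Qed.

(** Excludes [x = 1] with [a >= 2]. The ratios 2(2j + 1) / (j + 1) of central coefficients increase,
    so the two sides, equal at [b = 0], separate from then on. *)
Lemma central_log_convex a b : 2 <= a -> 0 < b ->
  'C(2 * a, a) * 'C(2 * b.+1, b.+1) < 2 * 'C(2 * (a + b), a + b).
Proof.
move=> a2; have step j :
    'C(2 * a, a) * 'C(2 * j.+1, j.+1) <= 2 * 'C(2 * (a + j), a + j) ->
    'C(2 * a, a) * 'C(2 * j.+2, j.+2) < 2 * 'C(2 * (a + j).+1, (a + j).+1).
  have e1 := central_succ j.+1; have e2 := central_succ (a + j).
  have C0 : 0 < 'C(2 * (a + j), a + j) by rewrite bin_gt0; lia.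
  move: e1 e2 C0; move: ('C(_, a)) ('C(_, j.+2)) ('C(_, j.+1)).
  move: ('C(_, (a + j).+1)) ('C(_, a + j)) => C' C A B' B e1 e2 C0 h.
  rewrite -(@ltn_pmul2l (j.+2 * (a + j).+1)) //.
  have -> : j.+2 * (a + j).+1 * (A * B')
    = 2 * (2 * j.+1).+1 * (a + j).+1 * (A * B).
    by rewrite [A * B']mulnC mulnACA e1; lia.
  have -> : j.+2 * (a + j).+1 * (2 * C')
    = 2 * (2 * (a + j)).+1 * j.+2 * (2 * C).
    by rewrite mulnACA e2; lia.
  apply: (@leq_ltn_trans (2 * (2 * j.+1).+1 * (a + j).+1 * (2 * C))).
    by rewrite leq_mul2l h orbT.
  by rewrite ltn_pmul2r ?muln_gt0 //; nia.
case: b => // b _; elim: b => [|b IHb]; rewrite addnS; apply: step.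
  by rewrite addn0 mulnC.
exact: ltnW.
Qed.

Lemma no_solution a b x : 2 <= a -> 2 <= x -> 0 < b ->
  'C(2 * (a + b), a + b) <> 'C(2 * a, a) * 'C(x + 2 * b, b).
Proof.
move=> a2 x2 b0 E.
have [leab|ltba] := leqP a b.
  have hx : 'C(2 * a + x, a) < 4 ^ a by apply: bin_lt_exp4_l E; lia.
  have lexa := x_le_m a2 hx.
  have [le8|lt8] := leqP a 8.
    have ex : x = 2.
      by have : x <= 2 by [apply: x_le2 hx; lia]; lia.
    by rewrite ex in E; apply: (no_small_l _ b0 leab E); lia.
  have lt9 : 8 < a <= b by rewrite lt8.
  apply: (no_smooth lt9 hx) => p t pp ht pt.
  apply: leq_trans (leq_addr _ _); apply: smooth_l E pp ht pt => //; lia.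
have hx := bin_lt_exp4_r b0 E.
(* For [b = 1] the bound [hx] would read 2 + x < 4. *)
have b2 : 2 <= b.
  rewrite ltnNge; apply/negP => b1; move: hx.
  by rewrite (_ : b = 1) ?bin1; lia.
have [le8|lt8] := leqP b 8.
  have ex : x = 2.
    by have : x <= 2 by [apply: x_le2 hx; lia]; lia.
  by rewrite ex in E; apply: (no_small_r _ _ E); lia.
have lt9 : 8 < b <= a by rewrite lt8 ltnW.
apply: (no_smooth lt9 hx) => p t pp ht pt.
by apply: smooth_r E pp _ pt; lia.
Qed.

Theorem theorem1p1 (k x b a : nat) (k_gt0 : 0 < k) (x_gt0 : 0 < x)
    (b_gt0 : 0 < b) (k_eq : k = a + b) :
  'C(2 * k, k) = 'C(2 * a, a) * 'C(x + 2 * b, b) <-> x = 1 /\ a = 1.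
Proof.
rewrite k_eq; split=> [E|[-> ->]]; last by rewrite central_double.
(* For [a = 0] and [a = 1] the equation compares two entries C(N, b), strictly increasing in N. For
   [a >= 2], log-convexity handles [x = 1] and [no_solution] the rest. *)
case: a E {k_gt0 k_eq} => [|[|a]] E.
- have : 'C(2 * b, b) < 'C(x + 2 * b, b) by apply: ltn_bin2l; lia.
  by move: E; rewrite mul1n add0n => ->; rewrite ltnn.
- split=> //; apply/eqP; rewrite eqn_leq x_gt0 andbT leqNgt; apply/negP => x2.
  have : 'C(1 + 2 * b, b) < 'C(x + 2 * b, b) by apply: ltn_bin2l; lia.
  by move: E; rewrite central_double => /eqP; rewrite eqn_pmul2l // => /eqP ->;
    rewrite ltnn.
- have [x1|x2] := leqP x 1; last by case: (no_solution _ x2 b_gt0 E).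
  have ex : x = 1 by lia.
  have := central_log_convex (isT : 2 <= a.+2) b_gt0.
  rewrite E ex -[b.+1]add1n central_double mulnCA ltnn; lia.
Qed.
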